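(* Let $G=(V,E)$ be a connected non-bipartite irreducible graph. For $v,w\in V$ let $c(v,w)=|N(v)\cap N(w)|$ be the number of common neighbors of $v$ and $w$ in $G$. Let $a_0>0$ be a fixed integer. If $c(v,w)=a_0$ whenever $v$ and $w$ are adjacent, and $c(v,w)\neq a_0$ whenever $v$ and $w$ are non-adjacent, then $$\mathrm{Aut}(G\times K_2)=\mathrm{Aut}(B(G))\cong \mathrm{Aut}(G)\times\mathbb{Z}_2,$$ in other words, $G$ is a stable graph.
   Context: All graphs are undirected, simple and finite. $N(v)$ denotes the set of neighbors of a vertex $v$. A graph is irreducible if $N(x)\neq N(y)$ for every pair of distinct vertices $x,y$. $\mathrm{Aut}(X)$ is the automorphism group of the graph $X$, and $\mathbb{Z}_2$ is the cyclic group of order 2. The bipartite double cover $B(G)=G\times K_2$ of $G=(V,E)$ is the graph with vertex-set $V\times\{0,1\}$ in which $(v,a)$ and $(w,b)$ are adjacent if and only if $a\neq b$ and $\{v,w\}\in E$. A graph $G$ is called stable if $\mathrm{Aut}(B(G))\cong\mathrm{Aut}(G)\times\mathbb{Z}_2$. *)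

(* Defs.v *)
From HB Require Import structures.
From mathcomp Require Import all_boot all_order all_algebra all_fingroup.

Set Implicit Arguments.
Unset Strict Implicit.
Unset Printing Implicit Defensive.

Local Open Scope group_scope.

Record sgraph := SGraph {
  vertex :> finType;
  adj : rel vertex;
  adj_sym : symmetric adj;
  adj_irrefl : irreflexive adj
}.

Section GraphNotions.

Variable G : sgraph.

Definition nbhd (v : G) : {set G} := [set w | adj v w].

Definition irreducible : Prop := forall x y : G, x != y -> nbhd x != nbhd y.

Definition connected : Prop := forall x y : G, connect (@adj G) x y.

Definition bipartite : Prop :=
  exists side : G -> bool, forall x y : G, adj x y -> side x != side y.

Definition common (v w : G) : nat := #|nbhd v :&: nbhd w|.

Definition graph_aut : {set {perm G}} :=
  [set s : {perm G} | [forall x, forall y, adj (s x) (s y) == adj x y]].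

Lemma graph_autP (s : {perm G}) :
  reflect (forall x y, adj (s x) (s y) = adj x y) (s \in graph_aut).
Proof.
rewrite inE; apply: (iffP forallP) => [H x y | H x].
  by have /forallP/(_ y)/eqP := H x.
by apply/forallP => y; rewrite H.
Qed.

Lemma graph_aut_group_set : group_set graph_aut.
Proof.
apply/group_setP; split; first by apply/graph_autP => x y; rewrite !perm1.
move=> s t /graph_autP Hs /graph_autP Ht.
by apply/graph_autP => x y; rewrite !permM Ht Hs.
Qed.

Canonical graph_aut_group : {group {perm G}} := Group graph_aut_group_set.

Definition bdc_adj : rel (G * bool)%type :=
  fun p q => (p.2 != q.2) && adj p.1 q.1.

Lemma bdc_adj_sym : symmetric bdc_adj.
Proof. by move=> p q; rewrite /bdc_adj eq_sym adj_sym. Qed.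

Lemma bdc_adj_irrefl : irreflexive bdc_adj.
Proof. by move=> p; rewrite /bdc_adj eqxx. Qed.

(* The bipartite double cover B(G) = G x K_2; the levels {0, 1} are booleans. *)
Definition double_cover : sgraph := SGraph bdc_adj_sym bdc_adj_irrefl.

End GraphNotions.

(* [setX A B] is the external direct product; the group law on ['Z_2] is addition. *)
Definition stable (G : sgraph) : Prop :=
  graph_aut (double_cover G) \isog setX (graph_aut G) [set: 'Z_2].

(* Main.v *)
(** An automorphism [phi] of B(G) shifts all levels by the same bit, because G is
    connected and not bipartite; so it is given by two permutations [F false],
    [F true] of V with [adj (F a v) (F (~~ a) w) = adj v w].  Each of them
    preserves the number of common neighbors, hence adjacency, since for
    distinct vertices adjacency means having exactly [a0] common neighbors.
    Then [F false w] and [F true w] have the same neighborhood, so they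
    coincide by irreducibility, and [phi] comes from Aut(G) x Z_2. *)
Require Import Defs.
From mathcomp Require Import all_boot all_order all_algebra all_fingroup.

Set Implicit Arguments.
Unset Strict Implicit.
Unset Printing Implicit Defensive.

Local Open Scope group_scope.

Section CoverLift.

Variable G : sgraph.

Definition cover_fun (u : {perm G} * 'Z_2) (p : double_cover G) :
    double_cover G := (u.1 p.1, p.2 (+) (u.2 != 0%R)).

Lemma cover_fun_inj u : injective (cover_fun u).
Proof. by move=> [x a] [y b] [/perm_inj -> /addIb ->]. Qed.

Definition cover_perm u : {perm double_cover G} := perm (@cover_fun_inj u).

Lemma cover_permE u x a : cover_perm u (x, a) = (u.1 x, a (+) (u.2 != 0%R)).
Proof. by rewrite permE. Qed.

(** Here [*] is the group law of ['Z_2], that is addition modulo 2; being nonzero turns it into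
    exclusive or on level bits. *)
Lemma Z2_mul_neq0 (z t : 'Z_2) :
  (z * t != 0%R) = (z != 0%R) (+) (t != 0%R).
Proof. by case: z t => [[|[|?]] ?] [[|[|?]] ?]. Qed.

Lemma Z2_neq0_inj : injective (fun z : 'Z_2 => z != 0%R).
Proof. by move=> [[|[|?]] ?] [[|[|?]] ?] // _; apply: val_inj. Qed.

Lemma cover_permM :
  {in setX (graph_aut G) [set: 'Z_2] &, {morph cover_perm : u v / u * v}}.
Proof.
move=> [s z] [t y] _ _; apply/permP => -[x a].
by rewrite permM !cover_permE /= permM Z2_mul_neq0 addbA.
Qed.

Canonical cover_morphism := Morphism cover_permM.

Lemma cover_perm_aut u :
  u.1 \in graph_aut G -> cover_perm u \in graph_aut (double_cover G).
Proof.
move=> /graph_autP u_aut; apply/graph_autP => -[x a] [y b].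
by rewrite !cover_permE /= /bdc_adj /= u_aut (inj_eq (@addIb _)).
Qed.

(** The ['Z_2] component is read off from the level of the image of [(x, false)]; with no vertex,
    both its values would act alike. *)
Lemma cover_perm_inj (x : G) : injective cover_perm.
Proof.
move=> [s z] [t y] /permP st; congr (_, _).
  by apply/permP => v; have := st (v, false); rewrite !cover_permE => -[].
by apply: Z2_neq0_inj; have := st (x, false); rewrite !cover_permE => -[].
Qed.

End CoverLift.

Lemma connected_const (G : sgraph) (T : Type) (f : G -> T) :
  connected G -> (forall v w, adj v w -> f v = f w) -> forall v w, f v = f w.
Proof.
move=> Gconn fadj v w; have /connectP[p] := Gconn v w.
elim: p v => [|u p IHp] v /= => [_ -> //|/andP[vu pu] /(IHp _ pu) <-].
exact: fadj.
Qed.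

Section CoverAutomorphism.

Variables (G : sgraph) (phi : {perm double_cover G}).
Hypothesis phi_aut : phi \in graph_aut (double_cover G).

Definition level_shift (v : G) (a : bool) : bool := (phi (v, a)).2 (+) a.

Definition level_fun (a : bool) (v : G) : G := (phi (v, a)).1.

(** The ends of an edge of the cover lie on opposite levels, and so do their images: both levels
    flip or neither does. *)
Lemma level_shift_adj v w a :
  adj v w -> level_shift v a = level_shift w (~~ a).
Proof.
move=> vw; have /graph_autP/(_ (v, a) (w, ~~ a)) := phi_aut.
rewrite /= /bdc_adj /= vw andbT /level_shift.
by case: (phi _).2; case: (phi _).2; case: a.
Qed.

Lemma level_shift_const : connected G -> ~ bipartite G ->
  forall v w a b, level_shift v a = level_shift w b.
Proof.
move=> Gconn Gnbip.
have shiftN v a : level_shift v (~~ a) = level_shift v a.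
  apply/eqP; apply: contra_notT Gnbip => neq_v.
  have neq w : level_shift w true != level_shift w false.
    (* Crossing an edge exchanges the shifts at the two levels, so whether they agree does not
       depend on the vertex. *)
    have := @connected_const _ _
      (fun u => level_shift u true == level_shift u false) Gconn _ v w.
    move=> <- => [|x y xy]; first by case: a neq_v => //=; rewrite eq_sym.
    by rewrite (level_shift_adj true xy) (level_shift_adj false xy) eq_sym.
  (* If they disagree everywhere, the shift at level [true] is a proper 2-coloring of [G]. *)
  exists (level_shift^~ true) => x y xy.
  by rewrite (level_shift_adj true xy) eq_sym neq.
have shiftT v a : level_shift v a = level_shift v true.
  by case: a => //; rewrite -shiftN.
move=> v w a b; rewrite (shiftT v) (shiftT w).
apply: (connected_const (f := level_shift^~ true)) => // x y xy.
by rewrite (level_shift_adj true xy) shiftT.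
Qed.

Hypothesis shift_const : forall v w a b, level_shift v a = level_shift w b.

(** With a constant shift, the images of [(v, a)] and [(w, a)] share their level, so equal first
    components make them equal. *)
Lemma level_fun_inj a : injective (level_fun a).
Proof.
move=> v w vw; have := shift_const v w a a.
move=> /addIb vw2; suff: (v, a) = (w, a) by case.
by apply: (@perm_inj _ phi); apply: injective_projections.
Qed.

Lemma level_fun_adj a v w :
  adj (level_fun a v) (level_fun (~~ a) w) = adj v w.
Proof.
have /graph_autP/(_ (v, a) (w, ~~ a)) := phi_aut.
rewrite /= /bdc_adj /=; have := shift_const v w a (~~ a).
rewrite /level_shift /level_fun.
by case: (phi _).2; case: (phi _).2; case: a.
Qed.

Lemma nbhd_level_fun a v :
  nbhd (level_fun a v) = level_fun (~~ a) @: nbhd v.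
Proof.
apply/setP => w; have [g _ gK] := injF_bij (@level_fun_inj (~~ a)).
by rewrite -(gK w) (mem_imset _ _ (@level_fun_inj _)) !inE level_fun_adj.
Qed.

Lemma common_level_fun a v w :
  common (level_fun a v) (level_fun a w) = common v w.
Proof.
rewrite /common !nbhd_level_fun -imsetI; last by move=> x y _ _; apply: level_fun_inj.
exact: card_imset (@level_fun_inj _).
Qed.

End CoverAutomorphism.

Theorem theorem3p17 (G : sgraph) (a0 : nat) :
  connected G ->
  ~ bipartite G ->
  irreducible G ->
  0 < a0 ->
  (forall v w : G, adj v w -> common v w = a0) ->
  (forall v w : G, v != w -> ~~ adj v w -> common v w <> a0) ->
  stable G.
Proof.
move=> Gconn Gnbip Girr _ common_adj common_nadj.
(* The empty graph is bipartite; otherwise [x] serves for injectivity and for reading off the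
   shift. *)
have [x _ | G0] := pickP (fun _ : G => true); last first.
  by case: Gnbip; exists xpredT => x; have := G0 x.
have adjE (v w : G) : adj v w = (v != w) && (common v w == a0).
  have [->|vw] := eqVneq v w; first by rewrite adj_irrefl.
  have [vw_adj | vw_nadj] := boolP (adj v w).
    by rewrite (common_adj _ _ vw_adj) eqxx.
  by have /eqP/negPf-> := common_nadj _ _ vw vw_nadj.
rewrite /stable isog_sym; apply/isogP; exists (cover_morphism G).
  by apply/injmP => u v _ _; apply: cover_perm_inj x u v.
apply/eqP; rewrite eqEsubset; apply/andP; split.
  apply/subsetP => _ /morphimP[[s z] _ /setXP[s_aut _] ->].
  exact: cover_perm_aut.
apply/subsetP => phi phi_aut.
have shift_const := level_shift_const phi_aut Gconn Gnbip.
pose F := level_fun phi; have F_inj := level_fun_inj shift_const.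
have F_adj a v w : adj (F a v) (F a w) = adj v w.
  by rewrite !adjE (inj_eq (@F_inj a)) (common_level_fun phi_aut).
have F_eq a v : F a v = F false v.
  (* Every vertex is some [F false w], and it is adjacent to [F true v], and likewise to
     [F false v], exactly when [w] is adjacent to [v]. *)
  case: a => //; apply/eqP/negPn/negP => /Girr/eqP[]; apply/setP => w.
  have [g _ gK] := injF_bij (@F_inj false).
  rewrite -(gK w) !inE -/(F _) F_adj.
  exact: (level_fun_adj phi_aut shift_const true).
(* The preimage of [phi]: its common action on vertices, and its constant shift as an element of
   ['Z_2]. *)
pose s := perm (@F_inj false); pose e := level_shift phi x false.
pose z : 'Z_2 := if e then 1%R else 0%R.
have -> : phi = cover_perm (s, z).
  apply/permP => -[v a]; rewrite cover_permE /=.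
  have -> : (z != 0%R) = e by rewrite /z; case: (e).
  rewrite permE -/(F _) -(F_eq a).
  have -> : e = level_shift phi v a by apply: shift_const.
  by rewrite /level_shift addbC addbK /F /level_fun; case: (phi _).
have sz_dom : (s, z) \in setX (graph_aut G) [set: 'Z_2].
  apply/setXP; split=> //; apply/graph_autP => v w.
  by rewrite !permE F_adj.
exact: (mem_morphim (cover_morphism G)).
Qed.
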